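(* Let $n$ and $d$ be positive integers and let $T_0\in \mathfrak{T}_n(d)$ be such that $W(T_0)=\max\{W(T): T\in \mathfrak{T}_n(d)\}$. Then every vertex of $T_0$ lies on a path of length $d$ in $T_0$.
   Context: All graphs are finite, connected, undirected, without loops or parallel edges. For vertices $u,v$ of a graph $G$, $d(u,v)$ is the number of edges in a shortest path joining them. The Wiener index of $G$ is $W(G)=\sum_{\{u,v\}\subseteq V(G)} d(u,v)$, the sum over all unordered pairs of vertices. The diameter of $G$ is $\max\{d(u,v):u,v\in V(G)\}$. $\mathfrak{T}_n(d)$ denotes the family of all trees on $n$ vertices with diameter $d$. The length of a path is its number of edges. *)

(* Defs.v *)
From mathcomp Require Import all_boot.

Set Implicit Arguments.
Unset Strict Implicit.
Unset Printing Implicit Defensive.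

Record sgraph := SGraph {
  vertex :> finType;
  adj : rel vertex;
  adj_sym : symmetric adj;
  adj_irrefl : irreflexive adj
}.

Arguments adj {s} : rename.

Section Graph.
Variable G : sgraph.

(* The path with vertices x :: p, listed in order; its length is size p. *)
Definition simple_path (x : G) (p : seq G) : bool :=
  path adj x p && uniq (x :: p).

Definition path_of_length (x y : G) (k : nat) : bool :=
  [exists p : k.-tuple G, simple_path x p && (last x p == y)].

(* A path has fewer than #|G| edges, so the search below finds the length of
   a shortest path whenever x and y are joined by one; otherwise it returns
   #|G|, a value that never occurs in a connected graph. *)
Definition dist (x y : G) : nat := find (path_of_length x y) (iota 0 #|G|).

(* Every unordered pair of distinct vertices is counted once, in the order
   given by the enumeration of the vertex type; pairs u = v would contribute
   0. *)
Definition wiener : nat :=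
  \sum_(u : G) \sum_(v : G | enum_rank u < enum_rank v) dist u v.

Definition diameter : nat := \max_(u : G) \max_(v : G) dist u v.

Definition connected : Prop := forall x y : G, connect adj x y.

(* ucycle also holds of the lists [:: x; y] that run back and forth along one
   edge, and of [::]; a cycle of a simple graph has at least 3 vertices. *)
Definition acyclic : Prop := forall c : seq G, ucycle adj c -> size c < 3.

Definition is_tree : Prop := connected /\ acyclic.

End Graph.

Definition tree_family (n d : nat) (T : sgraph) : Prop :=
  [/\ is_tree T, #|T| = n & diameter T = d].

(* The search in dist is exhaustive. *)
Lemma simple_path_size (G : sgraph) (x : G) (p : seq G) :
  simple_path x p -> size p < #|G|.
Proof. by case/andP=> _ /card_uniqP /= <-; apply: max_card. Qed.

Lemma path_of_lengthP (G : sgraph) (x y : G) (k : nat) :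
  reflect (exists p : seq G, [/\ simple_path x p, last x p = y & size p = k])
          (path_of_length x y k).
Proof.
apply: (iffP existsP) => [[p /andP[xp /eqP py]]|[p [xp py /eqP pk]]].
  by exists p; rewrite size_tuple.
by exists (Tuple pk); rewrite /= xp py eqxx.
Qed.

Lemma dist_le (G : sgraph) (x : G) (p : seq G) :
  simple_path x p -> dist x (last x p) <= size p.
Proof.
move=> xp; rewrite leqNgt; apply/negP=> /(before_find 0).
rewrite nth_iota ?(simple_path_size xp) // add0n => /path_of_lengthP[].
by exists p.
Qed.

Lemma dist_path (G : sgraph) (x y : G) : connect adj x y ->
  exists p : seq G, [/\ simple_path x p, last x p = y & size p = dist x y].
Proof.
case/connectP=> p0 /shortenP[p xp Up _] ->; apply/path_of_lengthP.
have sp : simple_path x p by rewrite /simple_path xp Up.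
have h : has (path_of_length x (last x p)) (iota 0 #|G|).
  apply/hasP; exists (size p); first by rewrite mem_iota (simple_path_size sp).
  by apply/path_of_lengthP; exists p.
have := nth_find 0 h; rewrite nth_iota ?add0n //.
by move: h; rewrite has_find size_iota.
Qed.

(* Main.v *)
(** Let [w] be a vertex lying on no geodesic of length [d] and adjacent to a
    vertex [u] lying on one, and let [B] be the branch at [w] of the tree minus
    the edge [uw].  Then [u] is not an end of its geodesic, which would extend
    to [w], so it has two neighbours [u1], [u2] on it.  Re-hanging [B] from [u]
    to either of them lengthens the distances out of [B], all smaller than [d],
    by at most one, so the diameter remains [d].  The distance to a fixed
    vertex is strictly convex along [u1, u, u2] in a tree, so that one of the
    two choices increases the Wiener index. *)
Require Import Defs.
From mathcomp Require Import all_boot zify.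

Set Implicit Arguments.
Unset Strict Implicit.
Unset Printing Implicit Defensive.

(** * Walks and distances *)

Lemma path_exit (V : finType) (e : rel V) (S : pred V) (x : V) (p : seq V) :
  path e x p -> S x -> ~~ S (last x p) ->
  exists p1 y p2, [/\ p = p1 ++ y :: p2, S (last x p1), ~~ S y
                    & e (last x p1) y].
Proof.
elim: p x => [|z p IHp] x /=; first by move=> _ ->.
case/andP=> exz ezp Sx nSl; have [Sz|nSz] := boolP (S z); last first.
  by exists [::], z, p; split.
have [p1 [y [p2 [-> Sl nSy ely]]]] := IHp z ezp Sz nSl.
by exists (z :: p1), y, p2; split.
Qed.

Section Distance.
Variable G : sgraph.
Implicit Types x y z : G.

Lemma dist_walk x (p : seq G) : path adj x p -> dist x (last x p) <= size p.
Proof.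
case/shortenP=> q xq Uq sub; apply: leq_trans (dist_le _) _.
  by rewrite /simple_path xq.
by apply: uniq_leq_size sub; case/andP: Uq.
Qed.

Lemma distxx x : dist x x = 0.
Proof. by apply/eqP; rewrite -leqn0; apply: (@dist_walk x [::]). Qed.

(** Shortening the walk to a simple path keeps only vertices of the walk, and the result is still at
    least as long as the distance; so nothing was repeated. *)
Lemma geodesic_simple x (p : seq G) :
  path adj x p -> size p <= dist x (last x p) -> simple_path x p.
Proof.
move=> xp; rewrite /simple_path xp /=; case/shortenP: (xp) => q xq Uq sub le.
rewrite -/(uniq (x :: p)); apply: (leq_size_uniq Uq).
  by move=> z; rewrite !inE => /orP[->//|/sub ->]; rewrite orbT.
by rewrite /= ltnS; apply: leq_trans le (dist_walk xq).
Qed.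

Lemma dist_diameter x y : dist x y <= diameter G.
Proof.
apply: leq_trans (leq_bigmax x).
exact: (leq_bigmax (F := fun z => dist x z)).
Qed.

Lemma diameter_attained : 0 < #|G| -> exists x y, dist x y = diameter G.
Proof.
move=> G0; have [x xE] := eq_bigmax (fun x : G => \max_(y : G) dist x y) G0.
have [y yE] := eq_bigmax (fun y : G => dist x y) G0.
by exists x, y; rewrite /diameter xE yE.
Qed.

Hypothesis conG : connected G.

Lemma dist0_eq x y : dist x y = 0 -> x = y.
Proof. by have [[|z p] [_ <- <-]] := dist_path (conG x y). Qed.

Lemma dist_sym_le x y : dist y x <= dist x y.
Proof.
have [p [/andP[xp _] <- <-]] := dist_path (conG x y).
rewrite -rev_path in xp.
have := dist_walk (_ : path adj (last x p) (rev (belast x p))).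
rewrite size_rev size_belast.
have -> : last (last x p) (rev (belast x p)) = x.
  by case: (p) => //= z q; rewrite rev_cons last_rcons.
by apply; rewrite (eq_path (e' := fun z => adj^~ z)) // => z t; apply: adj_sym.
Qed.

Lemma distC x y : dist x y = dist y x.
Proof. by apply/eqP; rewrite eqn_leq !dist_sym_le. Qed.

Lemma dist_triangle x y z : dist x z <= dist x y + dist y z.
Proof.
have [p [/andP[xp _] py <-]] := dist_path (conG x y).
have [q [/andP[yq _] qz <-]] := dist_path (conG y z).
have := @dist_walk x (p ++ q); rewrite last_cat py qz size_cat; apply.
by rewrite cat_path xp py.
Qed.

Lemma dist_adj x y : adj x y -> dist x y = 1.
Proof.
move=> xy; have le1 := @dist_walk x [:: y]; rewrite /= xy in le1.
apply/eqP; rewrite eqn_leq le1 // lt0n; apply/eqP=> /dist0_eq xy0.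
by rewrite xy0 adj_irrefl in xy.
Qed.

Lemma next_on_geodesic x y :
  x != y -> exists2 z, adj x z & dist x y = (dist z y).+1.
Proof.
move=> xy; have [[|z p] [/andP[xp _] py pk]] := dist_path (conG x y).
  by rewrite -py eqxx in xy.
case/andP: xp => xz zp; exists z => //; apply/eqP.
have := dist_triangle x z y; rewrite (dist_adj xz) add1n eqn_leq => -> /=.
by rewrite -pk ltnS -py; apply: dist_walk.
Qed.

(** Summing over ordered pairs removes the dependence on the enumeration order; the diagonal
    contributes 0. *)
Lemma wiener_double : wiener G + wiener G = \sum_(x : G) \sum_(y : G) dist x y.
Proof.
have -> : \sum_(x : G) \sum_(y : G) dist x y = wiener G +
    \sum_(x : G) \sum_(y : G | ~~ (enum_rank x < enum_rank y)) dist x y.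
  rewrite -big_split; apply: eq_bigr => x _.
  by rewrite (bigID (fun y => enum_rank x < enum_rank y)).
congr (_ + _); rewrite /wiener.
under eq_bigr do rewrite big_mkcond.
under [RHS]eq_bigr do rewrite big_mkcond.
rewrite exchange_big; apply: eq_bigr => x _; apply: eq_bigr => y _ /=.
case: ltngtP => // [_|/val_inj/enum_rank_inj ->]; first exact: distC.
by rewrite distxx.
Qed.
End Distance.

(** * Cuts crossed by a single edge *)

(** The side [S] is explicit data, so that one cut can serve two edge relations. *)
Definition bridge (V : finType) (e : rel V) (S : pred V) (a b : V) : Prop :=
  [/\ S a, ~~ S b, e a b & forall x y, S x -> ~~ S y -> e x y -> x = a /\ y = b].

Lemma bridgeC (V : finType) (e : rel V) (S : pred V) (a b : V) :
  symmetric e -> bridge e S a b -> bridge e (predC S) b a.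
Proof.
move=> es [Sa nSb eab only]; split=> //=; rewrite ?negbK // 1?es //.
by move=> x y nSx /negPn Sy exy; have [] := only y x Sy nSx; rewrite 1?es.
Qed.

Lemma bridge_cross (V : finType) (e : rel V) (S : pred V) (a b x : V) p :
  bridge e S a b -> path e x p -> S x -> ~~ S (last x p) ->
  exists p1 p2, p = p1 ++ b :: p2 /\ last x p1 = a.
Proof.
case=> _ _ _ only xp Sx nSl.
have [p1 [y [p2 [-> Sl nSy ely]]]] := path_exit xp Sx nSl.
by have [<- <-] := only _ _ Sl nSy ely; exists p1, p2.
Qed.

Lemma bridge_cross_mem (V : finType) (e : rel V) (S : pred V) (a b x : V) p :
  bridge e S a b -> path e x p -> S x -> ~~ S (last x p) ->
  a \in x :: p /\ b \in p.
Proof.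
move=> br xp Sx nSl; have [p1 [p2 [-> <-]]] := bridge_cross br xp Sx nSl.
by rewrite -cat_cons !mem_cat mem_last !inE eqxx orbT.
Qed.

(** Every crossing has [a] as its end in [S], so a path leaving [S] and returning would visit [a]
    twice. *)
Lemma bridge_simple_path_inside (V : finType) (e : rel V) (S : pred V)
    (a b x : V) p :
  symmetric e -> bridge e S a b -> path e x p -> uniq (x :: p) ->
  S x -> S (last x p) -> all S (x :: p).
Proof.
move=> es br xp Up Sx Sl; rewrite /= Sx; apply/allP=> z zp.
apply/negPn/negP=> nSz; case/splitPr: zp xp Up Sl => q1 q2.
rewrite last_cat cat_path -cat_cons cat_uniq /= => /and3P[xq1 eqz zq2].
case/and3P=> _ /norP[zq1 /hasPn q12] _ Sl.
have [|] := bridge_cross (bridgeC es br) zq2 nSz; first by rewrite /= negbK.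
move=> r1 [r2 [def_q2 _]].
have aq2 : a \in q2 by rewrite def_q2 mem_cat mem_head orbT.
have [] := @bridge_cross_mem _ _ _ _ _ x (rcons q1 z) br; rewrite ?last_rcons //.
  by rewrite rcons_path xq1.
rewrite -rcons_cons mem_rcons inE (negbTE (q12 _ aq2)) orbF => /eqP az.
by case: br nSz => Sa _ _ _; rewrite -az Sa.
Qed.

(** A shortest path must use the edge [ab], and its two remaining pieces bound [dist x a] and
    [dist b y]; the triangle inequality gives the converse. *)
Lemma dist_across_bridge (G : sgraph) (S : pred G) (a b x y : G) :
  connected G -> bridge adj S a b -> S x -> ~~ S y ->
  dist x y = dist x a + (dist b y).+1.
Proof.
move=> conG br Sx nSy; apply/eqP; rewrite eqn_leq; apply/andP; split.
  apply: leq_trans (dist_triangle conG x a y) _; rewrite leq_add2l.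
  apply: leq_trans (dist_triangle conG a b y) _.
  by case: br => _ _ ab _; rewrite (dist_adj conG ab).
have [p [/andP[xp _] py <-]] := dist_path (conG x y); rewrite -py in nSy *.
have [p1 [p2 [def_p p1a]]] := bridge_cross br xp Sx nSy.
move: xp; rewrite def_p last_cat size_cat cat_path /= => /and3P[xp1 _ bp2].
by rewrite -p1a; apply: leq_add; rewrite ?ltnS dist_walk.
Qed.

(** Stated for a bare relation, so that two edge sets on one vertex type can be compared; for [adj]
    it is [acyclic]. *)
Definition rel_acyclic (V : finType) (e : rel V) : Prop :=
  forall c, ucycle e c -> size c < 3.

(** [S] is what can be reached from [a] without the edge [ab]; were [b] in it, a path to [b] would
    close up with [ab] to a cycle. *)
Lemma acyclic_edge_bridge (V : finType) (e : rel V) (a b : V) :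
  symmetric e -> irreflexive e -> rel_acyclic e -> e a b ->
  exists S, bridge e S a b.
Proof.
move=> es ei acy ab.
pose e0 x y := e x y && ((x, y) \notin [:: (a, b); (b, a)]).
have not_ab : ~~ connect e0 a b.
  apply/negP=> /connectP[p0 /shortenP[p ap Up _] pb].
  have ap' : path e a p by apply: sub_path ap => x y /andP[].
  have := acy (a :: p); rewrite /ucycle Up /= rcons_path ap' -pb es ab.
  move=> /(_ isT).
  (* Acyclicity leaves only paths of length at most 1: length 0 would be a loop, and length 1 the
     deleted edge itself. *)
  case: p ap pb {ap' Up} => [|x [|y p]] //= ap pb; first by rewrite pb ei in ab.
  by move: ap; rewrite -pb /e0 !inE eqxx andbF.
exists (connect e0 a); split=> // x y ax ay exy.
have : ~~ e0 x y by apply: contra ay => /connect1; apply: connect_trans.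
rewrite /e0 exy negbK !inE !xpair_eqE => /orP[] /andP[/eqP xE /eqP yE] //.
by rewrite yE connect0 in ay.
Qed.

(** * Replacing the only edge across a cut *)

Section SwitchBridge.
Variables (V : finType) (e1 e2 : rel V) (S : pred V) (a b b' : V).
Hypotheses (s1 : symmetric e1) (s2 : symmetric e2).
Hypotheses (br1 : bridge e1 S a b) (br2 : bridge e2 S a b').
Hypothesis e12 : forall x y, S x = S y -> e1 x y = e2 x y.

Lemma switch_acyclic : rel_acyclic e1 -> rel_acyclic e2.
Proof.
move=> acy c cc; have [Sa nSb _ only] := br2.
have inside (P : pred V) : {in P &, e1 =2 e2} -> all P c -> size c < 3.
  move=> eP Pc; apply: acy; move: cc; rewrite /ucycle.
  by rewrite (eq_in_cycle eP).
have [Sc|] := boolP (all S c).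
  by apply: (inside _ _ Sc) => x y Sx Sy; rewrite e12 // [LHS]Sx [RHS]Sy.
case/allPn=> z zc nSz; have [nSc|] := boolP (all (predC S) c).
  apply: (inside _ _ nSc) => x y /negbTE Sx /negbTE Sy; rewrite e12 //.
  by rewrite Sx Sy.
case/allPn=> x xc /negPn Sx.
(* A cycle meeting both sides runs through the bridge, whose ends then
   separate it into two arcs, each lying on one side. *)
have [ac bc] : a \in c /\ b' \in c.
  have [i p def_p] := rot_to xc.
  have := cc; rewrite -(rot_ucycle i) def_p => /andP[cp _].
  move: zc; rewrite -!(mem_rot i c) def_p inE => /predU1P[zx|zp].
    by rewrite zx Sx in nSz.
  case/splitPr: zp cp => q1 q2.
  rewrite /= rcons_cat cat_path => /= /and3P[xq1 eqz _].
  have [] := @bridge_cross_mem _ _ _ _ _ x (rcons q1 z) br2.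
  - by rewrite rcons_path xq1.
  - by [].
  - by rewrite last_rcons.
  by rewrite -cat_rcons !inE !mem_cat => /orP[]-> ->; rewrite ?orbT.
have [i p def_p] := rot_to ac; rewrite -(size_rot i) def_p.
move: cc bc; rewrite -(rot_ucycle i) -(mem_rot i c) def_p inE => /andP[cp Up].
case/predU1P=> [ba|bp]; first by rewrite ba Sa in nSb.
case/splitPr: bp cp Up => q1 q2; rewrite -cat_cons cat_uniq /=.
rewrite rcons_cat cat_path rcons_cons /= rcons_path.
case/and4P=> aq1 eqb bq2 eqa /and3P[/andP[aq1' _]].
move=> /norP[bq1 /hasPn q12] /andP[bq2' _].
have last_id (y : V) q : y \notin q -> last y q = y -> q = [::].
  case/lastP: q => // q t; rewrite last_rcons mem_rcons => yq ty.
  by rewrite ty mem_head in yq.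
(* The vertex before [b'] lies in [S], as otherwise [q1] would already contain [b']; hence it is
   [a], and [q1] is empty. Likewise for [q2], so only the two vertices [a] and [b'] remain. *)
have -> : q1 = [::].
  apply: (last_id a) => //; apply: (only _ _ _ nSb eqb).1.
  apply/negPn/negP=> nSl; have [_] := bridge_cross_mem br2 aq1 Sa nSl.
  by move: bq1; rewrite inE => /norP[_ /negP].
have -> // : q2 = [::].
apply: (last_id b') => //; rewrite s2 in eqa; apply: (only _ _ Sa _ eqa).2.
apply/negP=> Sl; have [] := bridge_cross_mem (bridgeC s2 br2) bq2 nSb.
  by rewrite /= negbK.
by move=> _ /q12; rewrite mem_head.
Qed.

(** A simple path between vertices of the same side stays on that side, where the two relations
    agree. *)
Lemma switch_path x y p : S x = S y -> path e1 x p -> uniq (x :: p) ->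
  last x p = y -> path e2 x p.
Proof.
move=> Sxy xp Up py; have [Sx|nSx] := boolP (S x).
  have := bridge_simple_path_inside s1 br1 xp Up Sx.
  rewrite py -Sxy => /(_ Sx) Sp; have eS : {in S &, e1 =2 e2}.
    by move=> z t Sz St; rewrite e12 // [LHS]Sz [RHS]St.
  by rewrite -(eq_in_path eS Sp).
have := bridge_simple_path_inside s1 (bridgeC s1 br1) xp Up nSx.
rewrite py /= -Sxy => /(_ nSx) Sp; have eS : {in predC S &, e1 =2 e2}.
  by move=> z t /negbTE Sz /negbTE St; rewrite e12 // Sz St.
by rewrite -(eq_in_path eS Sp).
Qed.

Hypotheses (i1 : irreflexive e1) (i2 : irreflexive e2).
Let G1 := SGraph s1 i1.
Let G2 := SGraph s2 i2.
Hypothesis con1 : connected G1.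

Lemma switch_connected : connected G2.
Proof.
have con x y : S x = S y -> connect e2 x y.
  move=> Sxy; have [p [/andP[xp Up] py _]] := dist_path (con1 x y).
  by apply/connectP; exists p => //; apply: switch_path Up py.
have [Sa /negbTE nSb ab _] := br2; have cab := connect1 ab.
have cs : connect_sym e2 by apply: sym_connect_sym.
move=> x y; have [|] := boolP (S x == S y) => [/eqP/con//|].
have [Sx|/negbTE nSx] := boolP (S x); have [Sy|/negbTE nSy] := boolP (S y) => // _.
  apply: connect_trans (con x a _) (connect_trans cab (con _ _ _)); congruence.
rewrite [connect _ _ _]cs.
by apply: connect_trans (con y a _) (connect_trans cab (con _ _ _)); congruence.
Qed.

(** The two relations play symmetric roles, so using this in both directions shows that distances
    within a side are unchanged. *)
Lemma switch_dist_le x y : S x = S y -> @dist G2 x y <= @dist G1 x y.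
Proof.
move=> Sxy; have [p [/andP[xp Up] py <-]] := dist_path (con1 x y).
by rewrite -{1}py; apply: (@dist_walk G2); apply: switch_path Up py.
Qed.
End SwitchBridge.

(** * Convexity of distances and comparison of Wiener indices *)

(** Cut at the edge [u u1]. If [y] is on the side of [u], then [u1] is one step farther and [u2] at
    most one step nearer; otherwise [u1] is one step nearer and [u2] one step farther. *)
Lemma tree_dist_convex (G : sgraph) (u u1 u2 y : G) :
  is_tree G -> adj u u1 -> adj u u2 -> u1 != u2 ->
  dist u y + dist u y <= dist u1 y + dist u2 y.
Proof.
move=> [conG acyG] uu1 uu2 neq12.
have [S br] := acyclic_edge_bridge (@adj_sym G) (@adj_irrefl G) acyG uu1.
have [Su nSu1 _ only] := br; have [Sy|nSy] := boolP (S y).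
  rewrite (distC conG u1) (dist_across_bridge conG br Sy nSu1) distxx.
  have := dist_triangle conG u u2 y; rewrite (dist_adj conG uu2) (distC conG y).
  lia.
have Su2 : S u2.
  apply/negPn/negP=> nSu2; have [_ /eqP] := only _ _ Su nSu2 uu2.
  by rewrite eq_sym (negbTE neq12).
rewrite (dist_across_bridge conG br Su nSy).
rewrite (dist_across_bridge conG br Su2 nSy).
by rewrite distxx (distC conG u2) (dist_adj conG uu2); lia.
Qed.

Lemma wiener_split (G : sgraph) (S : pred G) : connected G ->
  wiener G + wiener G = \sum_(x : G) \sum_(y : G | S x == S y) dist x y
    + (\sum_(x : G | S x) \sum_(y : G | ~~ S y) dist x y).*2.
Proof.
move=> conG; rewrite wiener_double //.
under eq_bigr => x _ do rewrite (bigID (fun y => S x == S y)) /=.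
rewrite big_split /=; congr (_ + _); rewrite -addnn.
rewrite (bigID S) /=; congr (_ + _).
  by apply: eq_bigr => x Sx; apply: eq_bigl => y; rewrite Sx; case: (S y).
rewrite [RHS]exchange_big; apply: eq_bigr => x /negbTE Sx.
by apply: eq_big => [y|y _]; [rewrite Sx; case: (S y) | rewrite distC].
Qed.

(** Distances within a side do not change. For [x] in [S], the distances across are [dist x a + 1]
    plus the distance from [b] or [b'], so every such row grows by the same positive amount. *)
Lemma wiener_switch_lt (V : finType) (e1 e2 : rel V) (S : pred V) (a b b' : V)
    (s1 : symmetric e1) (s2 : symmetric e2)
    (i1 : irreflexive e1) (i2 : irreflexive e2)
    (G1 := SGraph s1 i1) (G2 := SGraph s2 i2) :
  bridge e1 S a b -> bridge e2 S a b' ->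
  (forall x y, S x = S y -> e1 x y = e2 x y) -> connected G1 ->
  \sum_(y | ~~ S y) @dist G1 b y < \sum_(y | ~~ S y) @dist G1 b' y ->
  wiener G1 < wiener G2.
Proof.
move=> br1 br2 e12 con1 lt_sum.
have con2 : connected G2 := switch_connected br1 br2 e12 con1.
have e21 x y : S x = S y -> e2 x y = e1 x y by move=> /e12.
have eq_dist x y : S x = S y -> @dist G2 x y = @dist G1 x y.
  move=> Sxy; apply/eqP; rewrite eqn_leq.
  by rewrite (switch_dist_le s2 br1 e12 i2) // (switch_dist_le s1 br2 e21 i1).
have [Sa nSb' _ _] := br2.
suff : wiener G1 + wiener G1 < wiener G2 + wiener G2 by lia.
rewrite (@wiener_split G1 S con1) (@wiener_split G2 S con2).
have -> : \sum_(x : G2) \sum_(y : G2 | S x == S y) dist x y =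
          \sum_(x : G1) \sum_(y : G1 | S x == S y) dist x y.
  by apply: eq_bigr => x _; apply: eq_bigr => y /eqP/eq_dist.
rewrite ltn_add2l ltn_double.
have cross (x : V) : S x ->
    \sum_(y : G1 | ~~ S y) @dist G1 x y < \sum_(y : G2 | ~~ S y) @dist G2 x y.
  move=> Sx.
  rewrite (eq_bigr _ (fun y => @dist_across_bridge G1 S a b x y con1 br1 Sx)).
  rewrite (eq_bigr _ (fun y => @dist_across_bridge G2 S a b' x y con2 br2 Sx)).
  rewrite !big_split /= eq_dist ?[LHS]Sx ?Sa // ltn_add2l.
  under eq_bigr do rewrite -add1n; under [X in _ < X]eq_bigr do rewrite -add1n.
  rewrite !big_split ltn_add2l; apply: leq_trans lt_sum _.
  rewrite leq_eqVlt; apply/orP; left; apply/eqP; apply: eq_bigr => y nSy.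
  by rewrite eq_dist // (negbTE nSy) (negbTE nSb').
(* The row of [a] shows that there is at least one strict increase. *)
rewrite (bigD1 a) //= [X in _ < X](bigD1 a) //= -addSn leq_add ?cross //.
by apply: leq_sum => x /andP[Sx _]; apply: ltnW (cross x Sx).
Qed.

(** * Diametral vertices and the re-hanging of a branch *)

(** Lying on a geodesic is expressed as equality in the triangle inequality. *)
Definition diametral (G : sgraph) : pred G := fun v =>
  [exists x, exists y,
    (dist x y == diameter G) && (dist x v + dist v y == diameter G)].

Lemma diametralP (G : sgraph) (v : G) :
  reflect (exists x y, dist x y = diameter G /\ dist x v + dist v y = diameter G)
          (diametral v).
Proof.
apply: (iffP existsP) => [[x /existsP[y /andP[/eqP xy /eqP xvy]]]|[x [y [xy xvy]]]].
  by exists x, y.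
by exists x; apply/existsP; exists y; rewrite xy xvy eqxx.
Qed.

Lemma diametral_path (G : sgraph) (v : G) : connected G -> diametral v ->
  exists x p, [/\ simple_path x p, size p = diameter G & v \in x :: p].
Proof.
move=> conG /diametralP[x [y [xy xvy]]].
have [p [/andP[xp _] pv sp]] := dist_path (conG x v).
have [q [/andP[vq _] qy sq]] := dist_path (conG v y).
have spq : size (p ++ q) = diameter G by rewrite size_cat sp sq.
exists x, (p ++ q); split=> //; last first.
  by rewrite -cat_cons mem_cat -pv mem_last.
apply: geodesic_simple; first by rewrite cat_path xp pv.
by rewrite last_cat pv qy spq xy.
Qed.

Lemma diametral_inner (G : sgraph) (u w : G) : is_tree G ->
  adj w u -> ~~ diametral w -> diametral u ->
  exists u1 u2, [/\ adj u u1, adj u u2, u1 != u2, u1 != w & u2 != w].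
Proof.
move=> treeG wu nw /diametralP[x [y [xy xuy]]].
have conG := treeG.1.
have off (z t : G) : dist z t = diameter G -> dist z w + dist w t != diameter G.
  by move=> zt; apply: contra nw => /eqP zwt; apply/diametralP; exists z, t.
have d_wu := dist_adj conG wu; have d_uw : dist u w = 1 by rewrite distC.
(* Suppose that [u] is the end [z], and cut at [uw]. If [t] is on the side of [u], then [dist t w]
   exceeds the diameter; otherwise [w] lies on the geodesic from [u] to [t], against [off]. *)
have inner (z t : G) : dist z t = diameter G -> dist z u + dist u t = diameter G ->
    exists2 u', adj u u' & dist u z = (dist u' z).+1.
  move=> zt zut; apply: next_on_geodesic => //; apply/eqP=> uz.
  have uw := adj_sym w u; rewrite wu in uw.
  have [S br] := acyclic_edge_bridge (@adj_sym G) (@adj_irrefl G) treeG.2 (esym uw).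
  have [Su nSw _ _] := br; have [St|nSt] := boolP (S t).
    have := dist_diameter t w; rewrite (dist_across_bridge conG br St nSw) distxx.
    by rewrite distC // -uz in zt; lia.
  have /eqP := off _ _ zt; apply; rewrite -uz d_uw -zt -uz.
  by rewrite (dist_across_bridge conG br Su nSt) distxx.
have [u1 uu1 xu1] := inner x y xy xuy.
have yx : dist y x = diameter G by rewrite distC.
have yux : dist y u + dist u x = diameter G.
  by rewrite distC // [dist u x]distC // addnC.
have [u2 uu2 yu2] := inner y x yx yux.
have xu := distC conG x u; have xu1' := distC conG x u1.
have xw := distC conG x w.
(* If [u1 = u2], then [x] and [y] are joined by a walk two steps too short; if either one is [w],
   then [w] lies on a geodesic from [x] to [y]. *)
exists u1, u2; split=> //; apply/eqP=> Eu; move: (off _ _ xy).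
- have := dist_triangle conG x u1 y; rewrite -Eu in yu2; lia.
- have := dist_triangle conG x w y; have := dist_triangle conG w u y.
  rewrite Eu in xu1; lia.
- have := dist_triangle conG x w y; have := dist_triangle conG x u w.
  rewrite Eu in yu2; lia.
Qed.

(* If the edge [ab] is a bridge with side [S], all other edges join vertices on
   the same side, and [ab] is thus replaced by [ab']. *)
Definition move_edge (V : finType) (e : rel V) (S : pred V) (a b' : V) : rel V :=
  fun x y => if S x == S y then e x y
             else ((x == a) && (y == b')) || ((x == b') && (y == a)).

Lemma move_edge_sym (V : finType) (e : rel V) (S : pred V) (a b' : V) :
  symmetric e -> symmetric (move_edge e S a b').
Proof.
move=> es x y; rewrite /move_edge eq_sym es orbC.
by rewrite [(x == a) && _]andbC [(x == b') && _]andbC.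
Qed.

Lemma move_edge_irrefl (V : finType) (e : rel V) (S : pred V) (a b' : V) :
  irreflexive e -> irreflexive (move_edge e S a b').
Proof. by move=> ei x; rewrite /move_edge eqxx ei. Qed.

Lemma move_edge_inside (V : finType) (e : rel V) (S : pred V) (a b' x y : V) :
  S x = S y -> e x y = move_edge e S a b' x y.
Proof. by rewrite /move_edge => ->; rewrite eqxx. Qed.

Lemma move_edge_bridge (V : finType) (e : rel V) (S : pred V) (a b' : V) :
  S a -> ~~ S b' -> bridge (move_edge e S a b') S a b'.
Proof.
move=> Sa nSb; split=> //; rewrite /move_edge.
  by rewrite Sa (negbTE nSb) !eqxx.
move=> x y Sx nSy; rewrite Sx (negbTE nSy) /=.
case/orP=> /andP[/eqP xE /eqP yE] //.
by rewrite -xE Sx in nSb.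
Qed.

Lemma move_edge_diameter (V : finType) (e1 e2 : rel V) (S : pred V) (a b b' : V)
    (s1 : symmetric e1) (s2 : symmetric e2)
    (i1 : irreflexive e1) (i2 : irreflexive e2)
    (G1 := SGraph s1 i1) (G2 := SGraph s2 i2) :
  bridge e1 S a b -> bridge e2 S a b' ->
  (forall x y, S x = S y -> e1 x y = e2 x y) -> connected G1 ->
  e1 b b' -> @diametral G1 b -> ~~ @diametral G1 a -> diameter G2 = diameter G1.
Proof.
move=> br1 br2 e12 con1 bb' diam_b ndiam_a.
have e21 x y : S x = S y -> e2 x y = e1 x y by move=> /e12.
have con2 : connected G2 := switch_connected br1 br2 e12 con1.
have eq_dist x y : S x = S y -> @dist G2 x y = @dist G1 x y.
  move=> Sxy; apply/eqP; rewrite eqn_leq.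
  by rewrite (switch_dist_le s2 br1 e12 i2) // (switch_dist_le s1 br2 e21 i1).
have [Sa nSb' _ _] := br2; have [_ nSb _ _] := br1.
(* A geodesic across the bridge contains [a], which is not diametral. *)
have lt_cross x y : S x -> ~~ S y -> @dist G1 x y < diameter G1.
  move=> Sx nSy; rewrite ltn_neqAle dist_diameter andbT.
  apply: contra ndiam_a => /eqP xy; apply/diametralP; exists x, y; split=> //.
  have ay := @dist_across_bridge G1 S a b a y con1 br1 Sa nSy.
  by rewrite -xy (@dist_across_bridge G1 S a b x y) // ay distxx.
have le_cross x y : S x -> ~~ S y -> @dist G2 x y <= diameter G1.
  move=> Sx nSy; have := lt_cross x y Sx nSy.
  rewrite (@dist_across_bridge G1 S a b x y) //.
  rewrite (@dist_across_bridge G2 S a b' x y) //.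
  rewrite (eq_dist x a) ?[LHS]Sx // (eq_dist b' y); last first.
    by rewrite (negbTE nSb') (negbTE nSy).
  have := @dist_triangle G1 con1 b' b y.
  rewrite [@dist G1 b' b]distC // (@dist_adj G1 con1 b b' bb').
  lia.
apply/eqP; rewrite eqn_leq; apply/andP; split.
  apply/bigmax_leqP=> x _; apply/bigmax_leqP=> y _.
  have [Sx|nSx] := boolP (S x); have [Sy|nSy] := boolP (S y).
  - by rewrite eq_dist ?dist_diameter // [LHS]Sx.
  - exact: le_cross.
  - by rewrite distC // le_cross.
  - by rewrite eq_dist ?dist_diameter // (negbTE nSx) (negbTE nSy).
(* By [lt_cross] the bridge cannot separate a pair at distance [diameter G1], so that distance
   survives in [G2]. *)
case/diametralP: diam_b => x [y [xy _]]; rewrite -xy -eq_dist.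
  exact: dist_diameter.
have [Sx|nSx] := boolP (S x); have [Sy|nSy] := boolP (S y) => //.
  by have := lt_cross x y Sx nSy; rewrite xy ltnn.
by have := lt_cross y x Sy nSx; rewrite distC // xy ltnn.
Qed.

(** * The maximality argument *)

Lemma wiener_max_diametral (n d : nat) (T0 : sgraph) : 0 < n ->
  tree_family n d T0 ->
  (forall T : sgraph, tree_family n d T -> wiener T <= wiener T0) ->
  forall v : T0, diametral v.
Proof.
case: T0 => V e es ei; set G := SGraph es ei => n_gt0 [treeG cardG diamG] maxG v.
have [conG acyG] := treeG.
have [//|nv] := boolP (diametral v); exfalso; rewrite -cardG in n_gt0.
have [x [y xy]] := diameter_attained n_gt0.
have dx : diametral x by apply/diametralP; exists x, y; rewrite distxx.
have [p xp pv] := connectP (conG x v); rewrite pv in nv.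
(* A walk from a diametral vertex to [v] leaves the set of diametral vertices along some edge
   [uw]. *)
have [p1 [w [_ [_ du nw uw]]]] := path_exit xp dx nv.
move: (last x p1) du uw => u du uw {x y xy dx p xp nv pv p1}.
have wu : e w u by rewrite es.
have [S br] := acyclic_edge_bridge es ei acyG wu.
have [Sw nSu _ only] := br.
have [u1 [u2 [uu1 uu2 neq12 neq1 neq2]]] := diametral_inner treeG wu nw du.
have outside u' : e u u' -> u' != w -> ~~ S u'.
  move=> uu'; apply: contra => Su'; rewrite es in uu'.
  by have [->] := only _ _ Su' nSu uu'.
(* Otherwise re-hanging the branch [S] of [w] from [u] to [u'] would give a tree of the same family
   with larger Wiener index. *)
have not_lt u' : e u u' -> u' != w ->
    \sum_(y | ~~ S y) @dist G u' y <= \sum_(y | ~~ S y) @dist G u y.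
  move=> uu' neq'; rewrite leqNgt; apply/negP=> lt_sum.
  have br' := move_edge_bridge e Sw (outside u' uu' neq').
  have e12 := @move_edge_inside V e S w u'.
  have s' := move_edge_sym S w u' es; have i' := move_edge_irrefl S w u' ei.
  have := maxG (SGraph s' i'); rewrite leqNgt => /(_ _)/negP; apply; last first.
    exact: wiener_switch_lt br br' e12 conG lt_sum.
  split=> //; last by rewrite -diamG; apply: move_edge_diameter br br' _ _ uu' du nw.
  split; first exact (switch_connected br br' e12 conG).
  exact: switch_acyclic s' br' e12 acyG.
(* Convexity holds termwise and is strict at [y = u], where it reads [0 < 2]; this contradicts
   [not_lt] for [u1] and [u2] together. *)
have : \sum_(y | ~~ S y) (@dist G u y + @dist G u y) <
       \sum_(y | ~~ S y) (@dist G u1 y + @dist G u2 y).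
  rewrite (bigD1 u) //= [X in _ < X](bigD1 u) //= -addSn leq_add //.
    have := @dist_adj G conG _ _ uu1; have := @dist_adj G conG _ _ uu2.
    by rewrite distxx ![@dist G u _]distC // => -> ->.
  by apply: leq_sum => y _; apply: (tree_dist_convex _ treeG).
rewrite !big_split /=.
by have := not_lt _ uu1 neq1; have := not_lt _ uu2 neq2; lia.
Qed.

Theorem theorem3p8 (n d : nat) (hn : 0 < n) (hd : 0 < d) (T0 : sgraph)
    (hT0 : tree_family n d T0)
    (hmax : forall T : sgraph, tree_family n d T -> wiener T <= wiener T0)
    (v : T0) :
  exists (x : T0) (p : seq T0),
    [/\ simple_path x p, size p = d & v \in x :: p].
Proof.
have [[conT _] _ <-] := hT0.
exact: diametral_path conT (wiener_max_diametral hn hT0 hmax v).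
Qed.
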